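(* Let $G$ be a simple connected graph with $n$ vertices and $m$ edges, let $k>2$ and $r\ge1$ be integers, and let $S_k^r(G)$ be the $r$-th iterated $k$-parallel subdivision graph of $G$. Then $$Ke(S_k^r(G))=4^rKe(G)+\frac{4^r-1}{6}(1-2n)+\frac{2^{r-1}k(k^r-2^r)}{k-2}m-\frac{k\big[4^r-2k(4^r-1)+3(2k)^r-4\big]}{6(k-2)(2k-1)}m.$$
   Context: The $k$-parallel subdivision graph $S_k(H)$ of a graph $H$ is obtained by replacing each edge $uv$ of $H$ by $k$ internally disjoint paths $u-w-v$ of length $2$ (each with its own new middle vertex). Iterates: $S_k^0(G)=G$ and $S_k^r(G)=S_k(S_k^{r-1}(G))$. For a connected graph $H$ on $N$ vertices, Kemeny's constant of the simple random walk on $H$ is $Ke(H)=\sum_{i=2}^{N}1/\lambda_i$, where $0=\lambda_1<\lambda_2\le\dots\le\lambda_N$ are the eigenvalues of the normalized Laplacian $I-D^{-1/2}AD^{-1/2}$ of $H$. *)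

(* Defs.v *)
From HB Require Import structures.
From mathcomp Require Import all_boot all_order all_algebra.
From Stdlib Require Import ClassicalEpsilon.
Set Implicit Arguments. Unset Strict Implicit. Unset Printing Implicit Defensive.
Import Order.TTheory GRing.Theory Num.Theory.
Local Open Scope ring_scope.

Record sgraph := SGraph {
  vert : finType;
  adj : rel vert;
  adj_sym : symmetric adj;
  adj_irr : irreflexive adj }.

Definition is_edge (G : sgraph) (A : {set vert G}) : bool :=
  [exists x, exists y, adj x y && (A == [set x; y])].
Definition edge (G : sgraph) : finType := {A : {set vert G} | is_edge A}.

Definition connected (G : sgraph) : Prop :=
  forall x y : vert G, connect (@adj G) x y.

Definition sub_vert (G : sgraph) (k : nat) : finType :=
  (vert G + (edge G * 'I_k))%type.

Definition sub_adj (G : sgraph) (k : nat) (u v : sub_vert G k) : bool :=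
  match u, v with
  | inl x, inr (e, _) => x \in val e
  | inr (e, _), inl x => x \in val e
  | _, _ => false
  end.

Lemma sub_adj_sym G k : symmetric (@sub_adj G k).
Proof. by case=> [x|[e i]] [y|[f j]]. Qed.

Lemma sub_adj_irr G k : irreflexive (@sub_adj G k).
Proof. by case=> [x|[e i]]. Qed.

Definition Sk (k : nat) (G : sgraph) : sgraph :=
  SGraph (@sub_adj_sym G k) (@sub_adj_irr G k).

Fixpoint Skr (k r : nat) (G : sgraph) : sgraph :=
  match r with
  | 0 => G
  | r'.+1 => Sk k (Skr k r' G)
  end.

Definition deg (G : sgraph) (x : vert G) : nat := #|[set y | adj x y]|.

Definition adjmx (R : rcfType) (G : sgraph) : 'M[R]_#|vert G| :=
  \matrix_(i, j) (adj (enum_val i) (enum_val j))%:R.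

Definition Dmhalf (R : rcfType) (G : sgraph) : 'M[R]_#|vert G| :=
  diag_mx (\row_i (Num.sqrt (deg (enum_val i))%:R)^-1).

Definition nlap (R : rcfType) (G : sgraph) : 'M[R]_#|vert G| :=
  1%:M - Dmhalf R G *m adjmx R G *m Dmhalf R G.

Definition spec_seq (R : rcfType) (n : nat) (A : 'M[R]_n) (s : seq R) : Prop :=
  sorted <=%R s /\ char_poly A = \prod_(x <- s) ('X - x%:P).

Definition eigs (R : rcfType) (G : sgraph) : seq R :=
  epsilon (inhabits [::]) (spec_seq (nlap R G)).

Definition kemeny (R : rcfType) (G : sgraph) : R :=
  \sum_(x <- behead (eigs R G)) x^-1.

(* Main.v *)
Require Import Defs.
From HB Require Import structures.
From mathcomp Require Import all_boot all_order all_algebra.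
From mathcomp Require Import perm complex ring zify.
From Stdlib Require Import ClassicalEpsilon.
Set Implicit Arguments. Unset Strict Implicit. Unset Printing Implicit Defensive.
Import Order.TTheory GRing.Theory Num.Theory.
Local Open Scope ring_scope.

(** If [p] is the characteristic polynomial of the normalized Laplacian [L] of
    a graph without isolated vertices, and [0] is a simple root of [p], then
    Kemeny's constant is [- p_2 / p_1]: the other roots are positive, and the
    sum of the inverses of the roots of [p / 'X] is minus the ratio of its two
    lowest coefficients.  The normalized Laplacian of [S_k(G)] is a block
    matrix with identity diagonal blocks and off-diagonal blocks [C], [C^T]
    such that [C C^T = 1 - L / 2].  Taking a block determinant,
      [p' = ('X - 1)^(km - n) * (- 1/2)^n * p (4 'X - 2 'X^2)],
    so [0] remains a simple root and
      [Ke(S_k(G)) = 4 Ke(G) + 1/2 + k m - n].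
    The closed formula follows by induction, using [m_r = (2k)^r m].  For the
    base graph, simplicity of the root [0] comes from the spectral theorem and
    the fact that the kernel of [L] is a line when [G] is connected. *)

(** * Real symmetric matrices and characteristic polynomials *)

Lemma char_poly_similar (F : fieldType) n (P A B : 'M[F]_n) :
  P \in unitmx -> P *m A = B *m P -> char_poly A = char_poly B.
Proof.
move=> Pu PA; rewrite /char_poly.
have Pp : \det (map_mx polyC P) != 0.
  by rewrite det_map_mx polyC_eq0 -unitfE -unitmxE.
apply: (mulfI Pp); rewrite -det_mulmx [RHS]mulrC -det_mulmx /char_poly_mx.
by rewrite mulmxBr mulmxBl -!map_mxM PA mul_mx_scalar mul_scalar_mx.
Qed.

(** Over [R[i]] a real symmetric matrix is Hermitian, so the spectral theorem diagonalizes it with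
    real eigenvalues: [d] can be taken over [R], while [P] stays complex. *)
Lemma sym_diag (R : rcfType) n (A : 'M[R]_n) : A^T = A ->
  exists (d : 'rV[R]_n) (P : 'M[R[i]]_n),
    P \in unitmx /\
    P *m map_mx (real_complex R) A
      = map_mx (real_complex R) (diag_mx d) *m P.
Proof.
move=> symA; set f := real_complex R.
have fA_real : map_mx f A \is a realmx.
  by apply/mxOverP => i j; rewrite !mxE complex_real.
have fA_sym : map_mx f A \is symmetricmx.
  by apply/is_hermitianmxP; rewrite expr0 scale1r map_mx_id // map_trmx symA.
have fA_herm := realsym_hermsym fA_sym fA_real.
have /orthomx_spectralP fAE := hermitian_normalmx fA_herm.
have /mxOverP sp_real := hermitian_spectral_diag_real fA_herm.
exists (map_mx (@complex.Re R) (spectral_diag (map_mx f A))).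
exists (spectralmx (map_mx f A)).
have Pu := spectral_unit (map_mx f A).
split=> //; rewrite {2}fAE !mulmxA mulmxV // mul1mx; congr (_ *m _).
rewrite map_diag_mx; congr diag_mx; apply/rowP => j; rewrite !mxE.
exact/esym/(RRe_real (sp_real 0 j)).
Qed.

Lemma sym_char_poly (R : rcfType) n (A : 'M[R]_n) (d : 'rV[R]_n)
    (P : 'M[R[i]]_n) :
  P \in unitmx ->
  P *m map_mx (real_complex R) A = map_mx (real_complex R) (diag_mx d) *m P ->
  char_poly A = \prod_i ('X - (d 0 i)%:P).
Proof.
move=> Pu PA; apply: (@map_poly_inj _ _ (real_complex R)).
rewrite map_char_poly (char_poly_similar Pu PA) -map_char_poly.
rewrite char_poly_trig ?diag_mx_is_trig //; congr map_poly.
by apply: eq_bigr => i _; rewrite mxE eqxx mulr1n.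
Qed.

Lemma sym_spec_seq (R : rcfType) n (A : 'M[R]_n) : A^T = A ->
  exists s, sorted <=%R s /\ char_poly A = \prod_(x <- s) ('X - x%:P).
Proof.
move=> /sym_diag[d [P [Pu PA]]].
exists (sort <=%R [seq d 0 i | i <- enum 'I_n]); split.
  exact/sort_sorted/le_total.
rewrite (sym_char_poly Pu PA) (perm_big _ (permEl (perm_sort _ _))) /=.
by rewrite big_map big_enum.
Qed.

(** If 0 were a double root, two distinct rows of the invertible matrix [P] would lie in the kernel
    of [A], which is at most a line, so they would be proportional. *)
Lemma sym_char_poly_coef1_neq0 (R : rcfType) n (A : 'M[R]_n) : A^T = A ->
  (\rank (kermx A) <= 1)%N -> (char_poly A)`_0 = 0 -> (char_poly A)`_1 != 0.
Proof.
move=> symA rkA p0; have [d [P [Pu PA]]] := sym_diag symA.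
have pE := sym_char_poly Pu PA.
have /eqP/prodf_eq0 [i _ di0] : \prod_i - d 0 i = 0.
  rewrite -p0 pE -horner_coef0 horner_prod; apply: eq_bigr => i _.
  by rewrite !hornerE ?add0r.
rewrite oppr_eq0 in di0; have {}di0 := eqP di0.
rewrite pE (bigD1 i) //= di0 subr0 coefXM /= -horner_coef0 horner_prod.
apply/negP => /prodf_eq0 [j nji]; rewrite !hornerE ?add0r oppr_eq0 => /eqP dj0.
set f := real_complex R in PA.
have kerP l : d 0 l = 0 -> (row l P <= kermx (map_mx f A))%MS.
  move=> dl0; apply/sub_kermxP; rewrite -row_mul PA row_mul.
  by rewrite map_diag_mx row_diag_mx mxE dl0 rmorph0 scale0r mul0mx.
have rowN0 : row i P != 0.
  apply/eqP => /(congr1 (mulmx^~ (invmx P))).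
  rewrite -row_mul mulmxV // mul0mx => /rowP/(_ i).
  by rewrite !mxE eqxx => /eqP; rewrite oner_eq0.
have /sub_rVP [a] : (row j P <= row i P)%MS.
  apply: submx_trans (kerP j dj0) _.
  rewrite -(geq_leqif (mxrank_leqif_sup (kerP i di0))).
  by rewrite -map_kermx mxrank_map (leq_trans rkA) // lt0n mxrank_eq0.
(* Multiplying by the inverse of [P] turns rows [i] and [j] into basis vectors; comparing column [j]
   gives 1 = 0. *)
move=> /(congr1 (mulmx^~ (invmx P))).
rewrite -scalemxAl -!row_mul mulmxV // => /rowP/(_ j); rewrite !mxE eqxx.
by rewrite eq_sym (negPf nji) mulr0 => /eqP; rewrite oner_eq0.
Qed.

(** The ratio of the two lowest coefficients is the logarithmic derivative of [q] at 0, that is, the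
    sum of the 1/(0 - x). *)
Lemma sum_inv_roots (F : fieldType) (s : seq F) :
  let q := \prod_(x <- s) ('X - x%:P) in
  q`_0 != 0 -> \sum_(x <- s) x^-1 = - (q`_1 / q`_0).
Proof.
rewrite /=; elim: s => [|x s IH].
  by rewrite !big_nil !coefC /= mul0r oppr0.
rewrite !big_cons; set q := \prod_(_ <- s) _ in IH *.
rewrite !mulrBl !coefB !coefXM !coefCM /= !sub0r oppr_eq0 mulf_eq0 negb_or.
case/andP=> x0 q0; rewrite IH // invrN mulrN opprK; field.
by rewrite x0 q0.
Qed.

Lemma sum_inv_behead_roots (R : realFieldType) (s : seq R) :
  let p := \prod_(x <- s) ('X - x%:P) in
  sorted <=%R s -> all (>= 0) s -> p`_0 = 0 -> p`_1 != 0 ->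
  \sum_(x <- behead s) x^-1 = - (p`_2 / p`_1).
Proof.
rewrite /=; case: s => [|x s].
  by rewrite big_nil coefC /= => _ _ /eqP; rewrite oner_eq0.
move=> sorted_s /= /andP[x_ge0 s_ge0].
have -> : \prod_(i <- x :: s) ('X - i%:P) =
    'X * \prod_(i <- s) ('X - i%:P) - x%:P * \prod_(i <- s) ('X - i%:P).
  by rewrite big_cons mulrBl.
rewrite !coefB !coefXM !coefCM /= sub0r => /eqP.
rewrite oppr_eq0 mulf_eq0 => /orP[/eqP ->|].
  by rewrite !mul0r !subr0; exact: sum_inv_roots.
(* Here 0 is a root of the tail; the head, nonnegative and minimal, is then 0 as well. *)
move=> q0; suff -> : x = 0.
  by rewrite !mul0r !subr0; exact: sum_inv_roots.
move: q0; rewrite -horner_coef0 horner_prod prodf_seq_eq0 => /hasP[y ys].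
rewrite !hornerE ?add0r oppr_eq0 => /eqP y0.
apply/le_anti; rewrite x_ge0 andbT -y0.
by move: sorted_s => /= /(order_path_min le_trans)/allP ->.
Qed.

(** The same permutation acts on rows and columns, so its sign is squared. The sizes [a] and [b] are
    distinct terms so that [f] can go from a block index type to the vertex index type of a
    subdivision. *)
Lemma det_mxsub_bij (A : comNzRingType) a b (f : 'I_a -> 'I_b) (M : 'M[A]_b) :
  bijective f -> \det (mxsub f f M) = \det M.
Proof.
move=> bij_f; have eab : a = b.
  by rewrite -[a]card_ord -[b]card_ord; exact: bij_eq_card bij_f.
case: _ / eab M f bij_f => M f /bij_inj inj_f.
have -> : mxsub f f M = row_perm (perm inj_f) (col_perm (perm inj_f) M).
  by apply/matrixP => i j; rewrite !mxE !permE.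
rewrite row_permE col_permE !det_mulmx !det_perm odd_permV.
by rewrite mulrCA -expr2 sqrr_sign mulr1.
Qed.

Lemma char_poly_mxsub_bij (A : comNzRingType) a b (f : 'I_a -> 'I_b)
    (M : 'M[A]_b) :
  bijective f -> char_poly (mxsub f f M) = char_poly M.
Proof.
move=> bij_f; rewrite /char_poly -(det_mxsub_bij _ bij_f); congr (\det _).
by apply/matrixP => i j; rewrite !mxE (inj_eq (bij_inj bij_f)).
Qed.

(* Multiplying on the right by the block matrix (y 0; -D 1) clears the lower
   left block. *)
Lemma det_block_scalar (A : idomainType) n q (y : A) (C : 'M[A]_(n, q))
    (D : 'M[A]_(q, n)) :
  y != 0 -> (n <= q)%N ->
  \det (block_mx y%:M C D y%:M) = y ^+ (q - n) * \det ((y ^+ 2)%:M - C *m D).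
Proof.
move=> y0 nq; apply: (mulIf (expf_neq0 n y0)).
have <- : \det (block_mx (y%:M : 'M_n) (0 : 'M_(n, q)) (- D) 1%:M) = y ^+ n.
  by rewrite det_lblock det_scalar det1 mulr1.
rewrite -det_mulmx mulmx_block.
rewrite !mulmx0 !mulmx1 !add0r !mulmxN -scalar_mxM -expr2.
rewrite mul_scalar_mx mul_mx_scalar subrr.
rewrite det_ublock det_scalar det_lblock det_scalar det1 mulr1.
rewrite mulrAC -exprD subnK //.
by rewrite mulrC.
Qed.

(** Take y = X - 1 in [det_block_scalar]: (X - 1)^2 - CD = X^2 - 2X + L/2 = -1/2 (4X - 2X^2 - L),
    and the scalar -1/2 leaves the determinant with exponent n. *)
Lemma char_poly_block (F : fieldType) n q (C : 'M[F]_(n, q)) (D : 'M[F]_(q, n))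
    (L : 'M[F]_n) :
  (2%:R : F) != 0 -> (n <= q)%N -> C *m D = 1%:M - 2%:R^-1 *: L ->
  char_poly (block_mx 1%:M C D 1%:M) =
  ('X - 1) ^+ (q - n) * ((- 2%:R^-1) ^+ n)%:P *
    (char_poly L \Po (4%:R *: 'X - 2%:R *: 'X^2)).
Proof.
move=> two0 nq CD; rewrite /char_poly.
have -> : char_poly_mx (block_mx 1%:M C D 1%:M) =
  block_mx ('X - 1)%:M (- map_mx polyC C) (- map_mx polyC D) ('X - 1)%:M.
  rewrite /char_poly_mx map_block_mx /= !map_scalar_mx /= scalar_mx_block.
  by rewrite opp_block_mx add_block_mx !sub0r !raddfB.
rewrite det_block_scalar ?polyXsubC_eq0 //.
rewrite mulNmx mulmxN opprK -map_mxM CD -mulrA; congr (_ * _).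
set h := 4%:R *: 'X - _.
rewrite -[_ \Po h]/(comp_poly h _) -det_map_mx polyC_exp -detZ.
have half2 : (2%:R^-1)%:P * 2 = 1 :> {poly F}.
  by rewrite -(polyC_natr F 2) -polyCM mulVf.
congr (\det _); apply/matrixP => i j; rewrite !mxE /= comp_polyB comp_polyC.
rewrite raddfMn /= comp_polyX polyCB polyCM polyCN raddfMn /= /h -!mul_polyC.
rewrite !polyC_natr.
set c := (2%:R^-1)%:P in half2 *; set l := (L i j)%:P.
case: (i == j); rewrite ?mulr1n ?mulr0n /=.
  (* The factor [c * 2], which is 1 by [half2], is exhibited because [ring] treats [c] as an
     atom. *)
  transitivity (c * 2 * ('X^2 - 2 * 'X) + c * l); last by ring.
  by rewrite half2; ring.
by ring.
Qed.

(** * Low-order coefficients under the quadratic substitution *)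

Lemma poly_jet2 (F : nzRingType) (p : {poly F}) :
  exists r, p = (p`_0)%:P + (p`_1)%:P * 'X + (p`_2)%:P * 'X^2 + r * 'X^3.
Proof.
exists (drop_poly 3 p); rewrite -{1}(poly_take_drop 3 p); congr (_ + _).
rewrite /take_poly poly_def !big_ord_recl big_ord0 addr0 /= -!mul_polyC.
by rewrite expr0 mulr1 expr1 addrA.
Qed.

Lemma exp_Xsub1_jet (F : comNzRingType) M :
  exists t : {poly F},
    ('X - 1) ^+ M = ((-1) ^+ M)%:P * (1 - M%:R * 'X + t * 'X^2).
Proof.
elim: M => [|M [t IH]]; first by exists 0; rewrite !expr0; ring.
(* The witness is the cofactor of X^2 in (1 - X)(1 - M X + t X^2). *)
exists (M%:R - t * 'X + t); rewrite exprS IH [(-1) ^+ M.+1]exprS polyCM polyCN.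
by rewrite -natr1; ring.
Qed.

Lemma coef_jet (F : nzRingType) (a b : F) (w : {poly F})
    (p := a%:P * 'X + b%:P * 'X^2 + w * 'X^3) :
  [/\ p`_0 = 0, p`_1 = a & p`_2 = b].
Proof.
rewrite /p; split; rewrite !coefD !coefMXn ?coefMX !coefC /= ?addr0 ?add0r //.
Qed.

(** With a and b the coefficients of p in degrees 1 and 2, the substitution gives 4a X + (16b - 2a)
    X^2 modulo X^3, and multiplying by 1 - M X adds -4Ma in degree 2. *)
Lemma coef_comp_jet (F : fieldType) (M : nat) (c : F) (p : {poly F})
    (p' := ('X - 1) ^+ M * c%:P * (p \Po (4%:R *: 'X - 2%:R *: 'X^2))) :
  p`_0 = 0 ->
  [/\ p'`_0 = 0, p'`_1 = (-1) ^+ M * c * (4%:R * p`_1) &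
   p'`_2 = (-1) ^+ M * c * (16%:R * p`_2 - 2%:R * p`_1 - 4%:R * M%:R * p`_1)].
Proof.
move=> p0; have [r pE] := poly_jet2 p; have [t tE] := exp_Xsub1_jet F M.
set a := p`_1 in pE *; set b := p`_2 in pE *.
pose a' := (-1) ^+ M * c * (4%:R * a).
pose b' := (-1) ^+ M * c * (16%:R * b - 2%:R * a - 4%:R * M%:R * a).
suff [w pE'] : exists w, p' = a'%:P * 'X + b'%:P * 'X^2 + w * 'X^3.
  by rewrite pE'; exact: coef_jet.
rewrite /p' {}pE p0 {}tE polyC0 add0r 
  !(comp_Xn_poly, comp_polyX, comp_polyC, comp_polyD, comp_polyM).
rewrite -!mul_polyC /a' /b' !(polyCM, polyCB, polyCN, polyC_natr).
set s := r \Po _; set e := (_ ^+ _)%:P.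
set A := a%:P; set B := b%:P; set C := c%:P.
(* The substituted polynomial is X g. The witness below collects all terms of degree at least 3,
   divided by X^3; its last three terms come from expanding [g] in the low-order terms. *)
pose g : {poly F} := 4 - 2 * 'X.
exists (e * C * (s * g ^+ 3 - M%:R * B * g ^+ 2 + t * A * g
  + 'X * (t * B * g ^+ 2 - M%:R * s * g ^+ 3) + 'X^2 * t * s * g ^+ 3
  - 16 * B + 4 * B * 'X + 2 * M%:R * A)).
by rewrite /g; ring.
Qed.

(** The common factor (-1)^M c cancels in the ratio. This is the recurrence for Kemeny's constant,
    to be used with M = km - n. *)
Lemma char_poly_ratio_comp (F : numFieldType) (M : nat) (c : F) (p : {poly F})
    (p' := ('X - 1) ^+ M * c%:P * (p \Po (4%:R *: 'X - 2%:R *: 'X^2))) :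
  c != 0 -> p`_0 = 0 -> p`_1 != 0 ->
  p'`_1 != 0 /\
  - (p'`_2 / p'`_1) = 4%:R * - (p`_2 / p`_1) + 2%:R^-1 + M%:R.
Proof.
move=> c0 p0 p1; have [_ -> ->] := coef_comp_jet M c p0.
have e0 : (-1) ^+ M != 0 :> F by rewrite signr_eq0.
split; first by rewrite !mulf_neq0 // pnatr_eq0.
by field; rewrite e0 p1 c0.
Qed.

(** * Degrees and edge counts *)

(** Positive degrees make the entries of [Dmhalf] genuine inverses instead of the default inverse of
    0. *)
Definition no_isolated (G : sgraph) := forall x : vert G, (0 < deg x)%N.

Lemma edge_neq (G : sgraph) (x y : vert G) : adj x y -> x != y.
Proof. by apply: contraTneq => ->; rewrite adj_irr. Qed.

Lemma edgeP (G : sgraph) (e : edge G) :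
  exists x y, adj x y /\ val e = [set x; y].
Proof.
by have /existsP[x /existsP[y /andP[xy /eqP ->]]] := valP e; exists x, y.
Qed.

Lemma is_edge_pair (G : sgraph) (x y : vert G) : adj x y -> is_edge [set x; y].
Proof.
by move=> xy; apply/existsP; exists x; apply/existsP; exists y; rewrite xy /=.
Qed.

Lemma edge_incident (G : sgraph) (e : edge G) (x : vert G) :
  x \in val e -> exists2 y, adj x y & val e = [set x; y].
Proof.
have [a [b [ab ->]]] := edgeP e; rewrite !inE => /orP[]/eqP ->.
  by exists b.
by exists a; rewrite 1?adj_sym // setUC.
Qed.

Lemma card_edge_set (G : sgraph) (e : edge G) : #|val e| = 2%N.
Proof. by have [x [y [xy ->]]] := edgeP e; rewrite cards2 edge_neq. Qed.

Lemma card_incident (G : sgraph) (x : vert G) :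
  #|[set e : edge G | x \in val e]| = deg x.
Proof.
rewrite -(card_imset _ val_inj) /deg.
rewrite -(@card_in_imset _ _ (fun y => [set x; y])).
  apply: eq_card => A; apply/imsetP/imsetP => [[e]|[y]]; rewrite inE.
    by case/edge_incident=> y xy Ae ->; exists y; rewrite ?inE.
  move=> xy ->; exists (Sub _ (is_edge_pair xy)); last by rewrite SubK.
  by rewrite inE SubK !inE eqxx.
move=> y z; rewrite !inE => xy xz /setP/(_ z); rewrite !inE eqxx orbT.
by rewrite eq_sym (negPf (edge_neq xz)) /= => /eqP.
Qed.

Lemma card_incident2 (G : sgraph) (x y : vert G) : x != y ->
  #|[set e : edge G | (x \in val e) && (y \in val e)]| = adj x y.
Proof.
move=> nxy; have [xy|nadj] := boolP (adj x y); last first.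
  apply: eq_card0 => e; rewrite !inE.
  apply/negP => /andP[/edge_incident[z xz ->]].
  rewrite !inE eq_sym (negPf nxy) /= => /eqP yz.
  by rewrite yz xz in nadj.
apply: etrans (cards1 (Sub _ (is_edge_pair xy) : edge G)).
apply: eq_card => e.
rewrite !inE; apply/idP/eqP => [/andP[/edge_incident[z xz ze]]|->]; last first.
  by rewrite SubK !inE !eqxx orbT.
rewrite ze !inE eq_sym (negPf nxy) /= => /eqP yz.
by apply: val_inj; rewrite SubK ze yz.
Qed.

Lemma handshake (G : sgraph) : (\sum_(x : vert G) deg x = 2 * #|edge G|)%N.
Proof.
under eq_bigr do rewrite -card_incident -sum1dep_card big_mkcond.
rewrite exchange_big /= -[RHS]mulnC -sum_nat_const; apply: eq_bigr => e _.
by rewrite -big_mkcond /= sum1_card card_edge_set.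
Qed.

Lemma no_isolated_card (G : sgraph) : no_isolated G ->
  (#|vert G| <= 2 * #|edge G|)%N.
Proof.
move=> niG; rewrite -handshake -sum1_card; exact: leq_sum.
Qed.

Lemma deg_Sk_vert (G : sgraph) (k : nat) (x : vert G) :
  @deg (Sk k G) (inl x) = (k * deg x)%N.
Proof.
have inrI : injective (inr : edge G * 'I_k -> vert (Sk k G)) by move=> a b [].
have -> : (k * deg x = #|setX [set e : edge G | x \in val e] [set: 'I_k]|)%N.
  by rewrite cardsX card_incident cardsT card_ord mulnC.
set E := setX _ _; rewrite -(card_imset (mem E) inrI).
apply: eq_card => -[y|[e i]].
  by rewrite inE; apply/esym/imsetP => -[[]].
by rewrite !inE mem_imset // !inE andbT.
Qed.

Lemma deg_Sk_mid (G : sgraph) (k : nat) (ei : edge G * 'I_k) :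
  @deg (Sk k G) (inr ei) = 2%N.
Proof.
have inlI : injective (inl : vert G -> vert (Sk k G)) by move=> a b [].
case: ei => e i; rewrite -(card_edge_set e) -(card_imset _ inlI).
apply: eq_card => -[y|f].
  by rewrite !inE mem_imset.
by rewrite inE; apply/esym/imsetP => -[].
Qed.

Lemma no_isolated_Sk (G : sgraph) (k : nat) : (0 < k)%N -> no_isolated G ->
  no_isolated (Sk k G).
Proof.
move=> k0 niG [x|ei]; last by rewrite deg_Sk_mid.
by rewrite deg_Sk_vert muln_gt0 k0 niG.
Qed.

Lemma card_vert_Sk (G : sgraph) (k : nat) :
  #|vert (Sk k G)| = (#|vert G| + k * #|edge G|)%N.
Proof. by rewrite card_sum card_prod card_ord mulnC. Qed.

(** Handshake in the subdivision: original vertices contribute 2km to the degree sum and the km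
    middle vertices contribute 2 each, for a total of 4km. *)
Lemma card_edge_Sk (G : sgraph) (k : nat) :
  #|edge (Sk k G)| = (2 * k * #|edge G|)%N.
Proof.
apply/eqP; rewrite -(eqn_pmul2l (isT : (0 < 2)%N)) -handshake; apply/eqP.
rewrite big_sumType /=.
under eq_bigr do rewrite deg_Sk_vert.
under [X in (_ + X)%N]eq_bigr do rewrite deg_Sk_mid.
rewrite -big_distrr /= handshake sum_nat_const card_prod card_ord.
by set m := #|edge G|; rewrite -/m; lia.
Qed.

Lemma connected_no_isolated (G : sgraph) : connected G -> (2 <= #|vert G|)%N ->
  no_isolated G.
Proof.
move=> conG n2 x; rewrite lt0n; apply/negP => /eqP/cards0_eq adj0.
have /card_gt0P[y] : (0 < #|[set~ x]|)%N by rewrite cardsC1; lia.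
rewrite !inE => nyx; have /connectP[[|z p]] := conG x y.
  by move=> _ yx; rewrite yx eqxx in nyx.
by move=> /= /andP[xz _]; move/setP/(_ z): adj0; rewrite !inE xz.
Qed.

(** * The normalized Laplacian *)

Definition sqrtdeg (R : rcfType) (G : sgraph) (x : vert G) : R :=
  Num.sqrt (deg x)%:R.

Lemma sqrtdeg_sqr (R : rcfType) (G : sgraph) (x : vert G) :
  sqrtdeg R x ^+ 2 = (deg x)%:R.
Proof. by rewrite sqr_sqrtr ?ler0n. Qed.

Lemma sqrtdeg_neq0 (R : rcfType) (G : sgraph) (x : vert G) :
  no_isolated G -> sqrtdeg R x != 0.
Proof. by move=> niG; rewrite gt_eqF // sqrtr_gt0 ltr0n. Qed.

Lemma nlapE (R : rcfType) (G : sgraph) i j :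
  nlap R G i j = (i == j)%:R -
    (adj (enum_val i) (enum_val j))%:R
      / (sqrtdeg R (enum_val i) * sqrtdeg R (enum_val j)).
Proof.
rewrite /nlap /Dmhalf mul_diag_mx mul_mx_diag !mxE; congr (_ - _).
by rewrite invfM -!/(sqrtdeg R _) mulrCA mulrA.
Qed.

Lemma nlap_sym (R : rcfType) (G : sgraph) : (nlap R G)^T = nlap R G.
Proof.
apply/matrixP => i j; rewrite mxE !nlapE eq_sym adj_sym.
by rewrite [sqrtdeg R (enum_val j) * _]mulrC.
Qed.

Lemma sum_adj (R : rcfType) (G : sgraph) (x : vert G) :
  \sum_(j < #|vert G|) (adj x (enum_val j))%:R = (deg x)%:R :> R.
Proof.
rewrite -(big_enum_val (fun y => (adj x y)%:R : R)) /= /deg.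
rewrite -sum1dep_card natr_sum [RHS]big_mkcond /=.
by apply: eq_big => // y _; case: (adj x y).
Qed.

(** This is the Dirichlet energy of g = v / [sqrtdeg]; the factor 1/2 is there because each edge is
    counted in both directions. *)
Lemma nlap_quad (R : rcfType) (G : sgraph) (v : 'rV[R]_#|vert G|) :
  no_isolated G ->
  (v *m nlap R G *m v^T) 0 0 =
  2%:R^-1 * \sum_i \sum_j (adj (enum_val i) (enum_val j))%:R *
    (v 0 i / sqrtdeg R (enum_val i) - v 0 j / sqrtdeg R (enum_val j)) ^+ 2.
Proof.
move=> niG; pose s (i : 'I_#|vert G|) := sqrtdeg R (enum_val i).
pose a (i j : 'I_#|vert G|) : R := (adj (enum_val i) (enum_val j))%:R.
pose g i := v 0 i / s i.
have vE i : v 0 i = g i * s i by rewrite /g mulfVK ?sqrtdeg_neq0.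
have S1 : \sum_i \sum_j a i j * g i ^+ 2 = \sum_i v 0 i ^+ 2.
  apply: eq_bigr => i _; rewrite -big_distrl /= sum_adj -sqrtdeg_sqr -/(s i) vE.
  by ring.
have S2 : \sum_i \sum_j a i j * g j ^+ 2 = \sum_i v 0 i ^+ 2.
  rewrite exchange_big -S1; apply: eq_bigr => i _; apply: eq_bigr => j _.
  by rewrite /a adj_sym.
rewrite -[X in _ * X]/(\sum_i \sum_j a i j * (g i - g j) ^+ 2).
have -> : \sum_i \sum_j a i j * (g i - g j) ^+ 2 =
   \sum_i v 0 i ^+ 2 + \sum_i v 0 i ^+ 2
     - 2 * \sum_i \sum_j a i j * (g i * g j).
  rewrite -{1}S1 -S2 big_distrr -big_split -sumrB /=; apply: eq_bigr => i _.
  rewrite big_distrr -big_split -sumrB /=; apply: eq_bigr => j _; ring.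
rewrite mxE; under eq_bigr => j _ do rewrite !mxE big_distrl /=.
rewrite exchange_big /=.
transitivity (\sum_i v 0 i ^+ 2 - \sum_i \sum_j a i j * (g i * g j));
  last by field.
rewrite -sumrB; apply: eq_bigr => i _.
(* The square of [v 0 i] is spread over [j] by a Kronecker delta, so that the sums match term by
   term. *)
rewrite [X in X - _](_ : _ = \sum_j (i == j)%:R * v 0 i * v 0 j); last first.
  rewrite (bigD1 i) //= eqxx mul1r big1 ?addr0 // => j /negPf.
  by rewrite eq_sym => ->; rewrite !mul0r.
rewrite -sumrB; apply: eq_bigr => j _.
rewrite nlapE -/(s i) -/(s j) -/(a i j) !vE.
have := @sqrtdeg_neq0 R G (enum_val i) niG; rewrite -/(s i) => si.
have := @sqrtdeg_neq0 R G (enum_val j) niG; rewrite -/(s j) => sj.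
by field; rewrite si sj.
Qed.

Lemma nlap_quad_ge0 (R : rcfType) (G : sgraph) (v : 'rV[R]_#|vert G|) :
  no_isolated G -> 0 <= (v *m nlap R G *m v^T) 0 0.
Proof.
move=> niG; rewrite nlap_quad //; apply: mulr_ge0.
  by rewrite invr_ge0 ler0n.
apply: sumr_ge0 => i _; apply: sumr_ge0 => j _.
by rewrite mulr_ge0 ?ler0n ?sqr_ge0.
Qed.

Lemma nlap_eig_ge0 (R : rcfType) (G : sgraph) (a : R) :
  no_isolated G -> root (char_poly (nlap R G)) a -> 0 <= a.
Proof.
move=> niG; rewrite -eigenvalue_root_char => /eigenvalueP[v vL v0].
have := nlap_quad_ge0 v niG; rewrite vL -scalemxAl mxE.
rewrite pmulr_lge0 // mxE.
have [i vi0] : exists i, v 0 i != 0.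
  apply/existsP; apply: contra_neqT v0 => /existsPn v0.
  by apply/rowP => i; rewrite mxE; apply/eqP/negPn.
rewrite (bigD1 i) //= ltr_pwDl ?mxE -?expr2 ?exprn_even_gt0 //.
by apply: sumr_ge0 => j _; rewrite mxE -expr2 sqr_ge0.
Qed.

(** Up to scaling, the entrywise square root of the stationary distribution of the walk; it serves
    as the eigenvector of [nlap] for the eigenvalue 0. *)
Definition sqrtdeg_row (R : rcfType) (G : sgraph) : 'rV[R]_#|vert G| :=
  \row_i sqrtdeg R (enum_val i).

Lemma nlap_ker (R : rcfType) (G : sgraph) :
  no_isolated G -> sqrtdeg_row R G *m nlap R G = 0.
Proof.
move=> niG; apply/rowP => j; rewrite !mxE.
under eq_bigr => i _ do rewrite mxE nlapE mulrBr.
rewrite sumrB (bigD1 j) //= eqxx mulr1 big1 ?addr0; last first.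
  by move=> i /negPf ->; rewrite mulr0.
have sj : sqrtdeg R (enum_val j) != 0 by exact: sqrtdeg_neq0.
apply/eqP; rewrite subr_eq0; apply/eqP; apply: (mulIf sj).
rewrite -expr2 sqrtdeg_sqr -sum_adj big_distrl /=; apply: eq_bigr => i _.
have si : sqrtdeg R (enum_val i) != 0 by exact: sqrtdeg_neq0.
by rewrite adj_sym; field; rewrite si sj.
Qed.

Lemma nlap_char0 (R : rcfType) (G : sgraph) :
  no_isolated G -> (0 < #|vert G|)%N -> (char_poly (nlap R G))`_0 = 0.
Proof.
move=> niG n0; rewrite -horner_coef0; apply/rootP.
rewrite -eigenvalue_root_char; apply/eigenvalueP; exists (sqrtdeg_row R G).
  by rewrite nlap_ker // scale0r.
apply/eqP => /rowP/(_ (Ordinal n0)); rewrite !mxE => /eqP.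
by rewrite (negPf (sqrtdeg_neq0 _ _ niG)).
Qed.

(** A kernel vector v has zero Dirichlet energy, so v / [sqrtdeg] is constant along edges, hence
    everywhere by connectedness: v is a multiple of [sqrtdeg_row]. *)
Lemma nlap_rank_ker (R : rcfType) (G : sgraph) :
  connected G -> no_isolated G -> (\rank (kermx (nlap R G)) <= 1)%N.
Proof.
move=> conG niG; apply: leq_trans (rank_leq_row (sqrtdeg_row R G)).
apply/mxrankS/rV_subP => v /sub_kermxP vL.
pose g x := v 0 (enum_rank x) / sqrtdeg R x.
have gadj x y : adj x y -> g x = g y.
  move=> xy; have := nlap_quad v niG; rewrite vL mul0mx mxE => /esym/eqP.
  rewrite mulf_eq0 invr_eq0 pnatr_eq0 /= psumr_eq0; last first.
    by move=> i _; apply: sumr_ge0 => j _; rewrite mulr_ge0 ?ler0n ?sqr_ge0.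
  move=> /allP/(_ (enum_rank x)); rewrite mem_index_enum => /(_ isT) /=.
  rewrite psumr_eq0; last first.
    by move=> j _; rewrite mulr_ge0 ?ler0n ?sqr_ge0.
  move=> /allP/(_ (enum_rank y)); rewrite mem_index_enum => /(_ isT) /=.
  by rewrite !enum_rankK xy mul1r sqrf_eq0 subr_eq0 => /eqP.
have gconn x y : connect (@adj G) x y -> g x = g y.
  case/connectP=> p; elim: p x => [|z p IH] x /=; first by move=> _ ->.
  by case/andP=> /gadj -> /IH.
have [n0|/card_gt0P[x0 _]] := posnP #|vert G|.
  have -> : v = 0 by apply/rowP => i; move: (ltn_ord i); rewrite {2}n0.
  exact: sub0mx.
apply/sub_rVP; exists (g x0); apply/rowP => i; rewrite !mxE.
rewrite (gconn x0 (enum_val i) (conG _ _)) /g enum_valK mulfVK //.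
exact: sqrtdeg_neq0.
Qed.

(** The list [eigs] is picked by [epsilon]; [sym_spec_seq] supplies a valid list, so the picked one
    also meets its specification. *)
Lemma kemeny_coef (R : rcfType) (G : sgraph) :
  let p := char_poly (nlap R G) in
  no_isolated G -> p`_0 = 0 -> p`_1 != 0 -> kemeny R G = - (p`_2 / p`_1).
Proof.
move=> p niG p0 p1; have [sorted_s pE] : spec_seq (nlap R G) (eigs R G).
  apply: epsilon_spec; have [s sP] := sym_spec_seq (nlap_sym R G).
  by exists s.
rewrite /kemeny; rewrite /p pE in p0 p1 *; apply: sum_inv_behead_roots => //.
apply/allP => x xs; apply: (nlap_eig_ge0 niG).
by rewrite pE root_prod_XsubC.
Qed.

(** * Parallel subdivision *)

(** Places original vertices before middle vertices, which puts the Laplacian of the subdivision in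
    block form. *)
Definition Sk_index (G : sgraph) (k : nat)
    (s : 'I_(#|vert G| + #|{: edge G * 'I_k}|)) : 'I_#|vert (Sk k G)| :=
  enum_rank (match split s with
             | inl i => inl (enum_val i)
             | inr j => inr (enum_val j)
             end : vert (Sk k G)).

Lemma Sk_index_bij (G : sgraph) (k : nat) : bijective (@Sk_index G k).
Proof.
apply: inj_card_bij; last by rewrite !card_ord card_sum.
move=> s t /enum_rank_inj; rewrite -(splitK s) -(splitK t) !unsplitK.
case: (split s) (split t) => [i|i] [j|j] //=.
  by move=> [] /enum_val_inj ->.
by move=> [] /enum_val_inj ->.
Qed.

(** A normalized, negated incidence matrix with k copies of each edge column. In [2 * k], the 2 is
    the degree of a middle vertex and k the growth factor of the degree of an original vertex. *)
Definition Sk_block (R : rcfType) (G : sgraph) (k : nat) :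
    'M[R]_(#|vert G|, #|{: edge G * 'I_k}|) :=
  \matrix_(i < #|vert G|, j < #|{: edge G * 'I_k}|)
    - ((enum_val i \in val (enum_val j).1)%:R
      / (sqrtdeg R (enum_val i) * Num.sqrt (2 * k)%:R)).

(** The subdivision is bipartite between original and middle vertices, whence the identity diagonal
    blocks. *)
Lemma nlap_Sk_block (R : rcfType) (G : sgraph) (k : nat) :
  mxsub (@Sk_index G k) (@Sk_index G k) (nlap R (Sk k G)) =
  block_mx 1%:M (Sk_block R G k) (Sk_block R G k)^T 1%:M.
Proof.
have sV x : @sqrtdeg R (Sk k G) (inl x) = Num.sqrt k%:R * sqrtdeg R x.
  by rewrite /sqrtdeg deg_Sk_vert natrM sqrtrM ?ler0n.
have sE f : @sqrtdeg R (Sk k G) (inr f) = Num.sqrt 2%:R.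
  by rewrite /sqrtdeg deg_Sk_mid.
have s2k : Num.sqrt (2 * k)%:R = Num.sqrt 2%:R * Num.sqrt k%:R :> R.
  by rewrite natrM sqrtrM ?ler0n.
apply/matrixP => s t; rewrite mxE nlapE (inj_eq (bij_inj (@Sk_index_bij G k))).
rewrite /Sk_index !enum_rankK.
case: (split_ordP s) => i -> ; case: (split_ordP t) => j ->.
- by rewrite block_mxEul /= mul0r subr0 mxE eq_lshift.
- rewrite block_mxEur mxE /= eq_lrshift sub0r sV sE s2k.
  case: (enum_val j) => e l /=; congr (- (_ / _)); ring.
- rewrite block_mxEdl !mxE /= eq_rlshift sub0r sV sE s2k.
  case: (enum_val i) => e l /=; congr (- (_ / _)); ring.
- case E: (enum_val i) => [e l]; case E': (enum_val j) => [e' l'].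
  by rewrite block_mxEdr /= mul0r subr0 mxE eq_rshift.
Qed.

(** Entry (x, y) is k times the number of edges containing both x and y, divided by 2k sqrt(deg x
    deg y). It equals 1/2 on the diagonal and half the normalized adjacency elsewhere. *)
Lemma Sk_block_mul (R : rcfType) (G : sgraph) (k : nat) :
  (0 < k)%N -> no_isolated G ->
  Sk_block R G k *m (Sk_block R G k)^T = 1%:M - 2%:R^-1 *: nlap R G.
Proof.
move=> k0 niG; apply/matrixP => i j.
transitivity ((i == j)%:R - 2%:R^-1 * nlap R G i j); last by rewrite !mxE.
rewrite mxE nlapE.
set x := enum_val i; set y := enum_val j.
have sx : sqrtdeg R x != 0 by exact: sqrtdeg_neq0.
have sy : sqrtdeg R y != 0 by exact: sqrtdeg_neq0.
have kR : k%:R != 0 :> R by rewrite pnatr_eq0 -lt0n.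
pose c := (sqrtdeg R x * sqrtdeg R y * (2 * k)%:R)^-1.
pose E2 := [set e : edge G | (x \in val e) && (y \in val e)].
transitivity (c * (k * #|E2|)%:R).
  have -> : (k * #|E2| = \sum_(p : edge G * 'I_k)
      ((x \in val p.1) && (y \in val p.1)))%N.
    rewrite -[k in LHS]card_ord -[#|'I_k|]cardsT mulnC -cardsX -sum1_card.
    rewrite big_mkcond /=; apply: eq_bigr => p _.
    by rewrite !inE andbT; case: (_ && _).
  rewrite natr_sum big_distrr (big_enum_val (fun p : edge G * 'I_k => _)) /=.
  apply: eq_bigr => l _; rewrite !mxE -/x -/y mulrNN.
  have s2k : Num.sqrt (2 * k)%:R != 0 :> R.
    by rewrite gt_eqF // sqrtr_gt0 ltr0n muln_gt0.
  have := sqr_sqrtr (ler0n R (2 * k)).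
  set q := Num.sqrt _ in s2k *; move=> qE.
  by rewrite /c -qE -mulnb natrM; field; rewrite sx sy s2k.
have [eij|nij] := eqVneq i j.
  have -> : E2 = [set e : edge G | x \in val e].
    by apply/setP => e; rewrite !inE /y -eij andbb.
  rewrite card_incident /c /y -eij adj_irr -/x !natrM -(sqrtdeg_sqr R x) /=.
  by field; rewrite sx kR.
have nxy : x != y by rewrite (inj_eq enum_val_inj).
rewrite card_incident2 // /c !natrM /=.
by field; rewrite sx sy kR.
Qed.

Lemma char_poly_Sk (R : rcfType) (G : sgraph) (k : nat) :
  (0 < k)%N -> no_isolated G -> (#|vert G| <= k * #|edge G|)%N ->
  char_poly (nlap R (Sk k G)) =
  ('X - 1) ^+ (k * #|edge G| - #|vert G|) * ((- 2%:R^-1) ^+ #|vert G|)%:P *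
    (char_poly (nlap R G) \Po (4%:R *: 'X - 2%:R *: 'X^2)).
Proof.
move=> k0 niG le_n; rewrite -(char_poly_mxsub_bij _ (@Sk_index_bij G k)).
have cE : #|{: edge G * 'I_k}| = (k * #|edge G|)%N.
  by rewrite card_prod card_ord mulnC.
rewrite nlap_Sk_block -cE; apply: char_poly_block.
- by rewrite pnatr_eq0.
- by rewrite cE.
- exact: Sk_block_mul.
Qed.

(** The invariant carried through the iteration. The bound n <= km makes the truncated subtraction
    km - n exact; the last clause, with 0 a root, says that this root is simple, and it is
    propagated in place of connectedness. *)
Definition kemeny_admissible (R : rcfType) (k : nat) (G : sgraph) : Prop :=
  [/\ no_isolated G, (0 < #|vert G|)%N, (#|vert G| <= k * #|edge G|)%N
    & (char_poly (nlap R G))`_1 != 0].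

Lemma kemeny_Sk (R : rcfType) (k : nat) (G : sgraph) :
  (0 < k)%N -> kemeny_admissible R k G ->
  kemeny_admissible R k (Sk k G) /\
  kemeny R (Sk k G) = 4%:R * kemeny R G + 2%:R^-1
    + k%:R * #|edge G|%:R - #|vert G|%:R.
Proof.
move=> k0 [niG n0 le_n p1].
have p0 := nlap_char0 R niG n0.
have niS := no_isolated_Sk k0 niG.
have n0S : (0 < #|vert (Sk k G)|)%N by rewrite card_vert_Sk addn_gt0 n0.
have c0 : (- 2%:R^-1) ^+ #|vert G| != 0 :> R.
  by rewrite expf_neq0 // oppr_eq0 invr_eq0 pnatr_eq0.
have [] := char_poly_ratio_comp (k * #|edge G| - #|vert G|) c0 p0 p1.
rewrite -char_poly_Sk // => p1S ke; split.
  split=> //; rewrite card_vert_Sk card_edge_Sk.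
  (* The bound to preserve is n + km <= k(2km), which follows from n <= km and k >= 1. *)
  by move: #|edge G| #|vert G| le_n => m n; nia.
rewrite (kemeny_coef niS (nlap_char0 R niS n0S) p1S) ke -kemeny_coef //.
by rewrite natrB // natrM addrA.
Qed.

Lemma connected_admissible (R : rcfType) (k : nat) (G : sgraph) :
  connected G -> (2 <= #|vert G|)%N -> (2 <= k)%N -> kemeny_admissible R k G.
Proof.
move=> conG n2 k2; have niG := connected_no_isolated conG n2.
split=> //; first exact: ltnW.
  (* By the handshake lemma n <= 2m, and 2m <= km. *)
  by apply: leq_trans (no_isolated_card niG) _; rewrite leq_mul2r k2 orbT.
apply: sym_char_poly_coef1_neq0; [exact: nlap_sym | exact: nlap_rank_ker |].
by apply: nlap_char0 => //; exact: ltnW.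
Qed.

(** * Iterated subdivisions and the closed formula *)

Lemma admissible_Skr (R : rcfType) (k r : nat) (G : sgraph) :
  (0 < k)%N -> kemeny_admissible R k G -> kemeny_admissible R k (Skr k r G).
Proof.
by move=> k0 admG; elim: r => //= r IH; have [] := kemeny_Sk k0 IH.
Qed.

Lemma card_edge_Skr (k r : nat) (G : sgraph) :
  #|edge (Skr k r G)| = ((2 * k) ^ r * #|edge G|)%N.
Proof.
elim: r => [|r IH]; first by rewrite mul1n.
by rewrite card_edge_Sk IH mulnA expnS.
Qed.

(** Step s adds k (2k)^s m vertices; the quotient is the resulting geometric sum, hence the cast to
    a field. *)
Lemma card_vert_Skr (R : numFieldType) (k r : nat) (G : sgraph) : (0 < k)%N ->
  #|vert (Skr k r G)|%:R = #|vert G|%:R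
    + k%:R * #|edge G|%:R * (((2%:R * k%:R) ^+ r - 1) / (2%:R * k%:R - 1)) :> R.
Proof.
move=> k0; have k1 : 2%:R * k%:R - 1 != 0 :> R.
  by rewrite subr_eq0 -natrM pnatr_eq1; lia.
elim: r => [|r IH]; first by rewrite subrr mul0r mulr0 addr0.
rewrite card_vert_Sk natrD IH card_edge_Skr !natrM natrX natrM exprS.
by field.
Qed.

Theorem theorem4p7 (R : rcfType) (G : sgraph) (k r : nat) :
  connected G -> (2 <= #|vert G|)%N -> (2 < k)%N -> (1 <= r)%N ->
  let n := #|vert G| in
  let m := #|edge G| in
  kemeny R (Skr k r G) =
    4%:R ^+ r * kemeny R G
    + (4%:R ^+ r - 1) / 6%:R * (1 - 2%:R * n%:R)
    + (2%:R ^+ r.-1 * k%:R * (k%:R ^+ r - 2%:R ^+ r)) / (k%:R - 2%:R) * m%:R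
    - (k%:R * (4%:R ^+ r - 2%:R * k%:R * (4%:R ^+ r - 1)
               + 3%:R * (2%:R * k%:R) ^+ r - 4%:R))
      / (6%:R * (k%:R - 2%:R) * (2%:R * k%:R - 1)) * m%:R.
Proof.
move=> conG n2 k2 r1 n m; have k0 : (0 < k)%N by exact: leq_trans k2.
have admG := connected_admissible R conG n2 (ltnW k2).
have k2N0 : k%:R - 2%:R != 0 :> R by rewrite subr_eq0 eqr_nat; lia.
have k1N0 : 2%:R * k%:R - 1 != 0 :> R.
  by rewrite subr_eq0 -natrM pnatr_eq1; lia.
(* Shifting [r] by one removes the predecessor in the exponent of 2; the induction below therefore
   starts from a single subdivision. *)
case: r r1 => // r _ /=.
have step s : kemeny R (Sk k (Skr k s G)) =
    4%:R * kemeny R (Skr k s G) + 2%:R^-1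
    + k%:R * #|edge (Skr k s G)|%:R - #|vert (Skr k s G)|%:R.
  by have [] := kemeny_Sk k0 (admissible_Skr s k0 admG).
elim: r => [|r IH].
  by rewrite step /= expr0 !expr1 -/n -/m; field; rewrite k2N0 k1N0.
rewrite step card_edge_Skr card_vert_Skr //= IH -/n -/m !natrM natrX natrM.
rewrite !exprS !exprMn.
(* The powers of 4 and 2 must be expressed through one atom before [field] can relate them. *)
have -> : 4%:R ^+ r = (2%:R ^+ r) ^+ 2 :> R by rewrite exprAC -(natrX _ 2 2).
by field; rewrite k2N0 k1N0.
Qed.
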